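(* Let $g$ be the asymptotic gain rate at $\rho$ of $\mathcal{C}$ and $\epsilon_n=e^{-\kappa(n)n}$ with $\kappa(n)=o(1)$. Assume the i.i.d. scenario with respect to a distribution $\nu$ of $RZE$ with $\rho=\nu[CZ]$. Then for any $\delta>0$, there exist $\beta>0$ and a function $G$ of $CZ$ such that $G^\beta$ is a PEF with power $\beta$ for $\mathcal{C}$ and, with probability tending to $1$ as $n\to\infty$, the net log-prob after $n$ trials with PEFs $F_i=G(C_iZ_i)^\beta$ and error bound $\epsilon_n$, namely $$\sum_{i=1}^n\log(F_i)/\beta-\log(1/\epsilon_n)/\beta,$$ exceeds $(g-\delta)n$.
   Context: All random variables have finite value spaces; $C$ is a function of $R$ and $D$ is a function of $C$. $\mathcal{C}$ is a set of distributions of $CZ$. $\log$ is natural with $\log0=-\infty$; expectations are sums over values of positive probability only. PEF: a probability estimation factor with power $\beta>0$ for $\mathcal{C}$ (and $D|Z$) is a non-negative function $F=F(CZ)$ such that $\mathbb{E}_\sigma(F(CZ)\,\sigma(D|Z)^\beta)\le1$ for all $\sigma\in\mathcal{C}$. Its log-prob rate at $\rho$ is $\mathbb{E}_\rho(\log F(CZ))/\beta$. The asymptotic gain rate at $\rho$ of $\mathcal{C}$ is the supremum of the log-prob rates at $\rho$ achievable by PEFs with positive power for $\mathcal{C}$. I.i.d. scenario with respect to $\nu$: the trial RVs $R_iZ_iE_i$, $i\ge1$, are i.i.d. with distribution $\nu$ (a distribution of $RZE$) such that for all values $e$ of $E$ of positive probability, $\nu[CZ|E=e]\in\mathcal{C}$.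 *)

(* Defs.v *)
From HB Require Import structures.
From mathcomp Require Import all_boot all_order all_algebra.
From mathcomp Require Import finmap.
From mathcomp Require Import all_classical all_reals all_analysis.

Set Implicit Arguments.
Unset Strict Implicit.
Unset Printing Implicit Defensive.

Import Order.TTheory GRing.Theory Num.Theory.
Import numFieldNormedType.Exports.

Local Open Scope classical_set_scope.
Local Open Scope ring_scope.

Definition distribution_on (R : realType) (V : finType) (p : V -> R) : Prop :=
  (forall v, 0 <= p v) /\ \sum_v p v = 1.

(* The law of f, seen as a random variable on the finite probability space
   (V, p). *)
Definition dist_of (R : realType) (V W : finType) (p : V -> R)
    (f : V -> W) : W -> R :=
  fun w => \sum_(v | f v == w) p v.

(* p(f = w | g = u); it has the junk value 0 when p(g = u) = 0. *)
Definition cond_dist (R : realType) (V W U : finType) (p : V -> R)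
    (f : V -> W) (g : V -> U) (w : W) (u : U) : R :=
  (\sum_(v | (f v == w) && (g v == u)) p v) / dist_of p g u.

(* Here and below, CT, DT, ZT, ... are the value spaces of C, D, Z, ..., and
   D : CT -> DT expresses D as a function of C. A distribution of CZ is a
   function on CT * ZT. *)

Definition cond_D_given_Z (R : realType) (CT DT ZT : finType) (D : CT -> DT)
    (sigma : CT * ZT -> R) (cz : CT * ZT) : R :=
  cond_dist sigma (fun x => D x.1) snd (D cz.1) cz.2.

Definition PEF (R : realType) (CT DT ZT : finType) (D : CT -> DT)
    (Cset : set (CT * ZT -> R)) (beta : R) (F : CT * ZT -> R) : Prop :=
  [/\ 0 < beta,
      forall cz, 0 <= F cz &
      forall sigma, Cset sigma ->
        \sum_(cz | 0 < sigma cz)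
          sigma cz * (F cz * (cond_D_given_Z D sigma cz) `^ beta) <= 1].

(* Extended-real valued, since log 0 = -oo. *)
Definition log_prob_rate (R : realType) (CT ZT : finType)
    (rho : CT * ZT -> R) (beta : R) (F : CT * ZT -> R) : \bar R :=
  ((\sum_(cz | (0 < rho cz)%R) (rho cz)%:E * lne (F cz)%:E) / beta%:E)%E.

Definition asymptotic_gain_rate (R : realType) (CT DT ZT : finType)
    (D : CT -> DT) (Cset : set (CT * ZT -> R)) (rho : CT * ZT -> R) : \bar R :=
  ereal_sup [set x | exists (beta : R) (F : CT * ZT -> R),
                       PEF D Cset beta F /\ x = log_prob_rate rho beta F].

(* CZ as a random variable on the value space of RZE; the variable E is snd. *)
Definition CZ_of (RT CT ZT ET : finType) (C : RT -> CT)
    (rze : RT * ZT * ET) : CT * ZT :=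
  (C rze.1.1, rze.1.2).

(* Measurability is with respect to the discrete sigma-algebra of V. *)
Definition random_variables (d : measure_display)
    (T : measurableType d) (V : finType) (X : nat -> T -> V) : Prop :=
  forall i (A : set V), measurable (X i @^-1` A).

Definition mutually_independent (R : realType) (d : measure_display)
    (T : measurableType d) (P : probability T R) (V : finType)
    (X : nat -> T -> V) : Prop :=
  forall (J : {fset nat}) (A : nat -> set V),
    P (\bigcap_(i in [set` J]) (X i @^-1` A i)) =
    (\prod_(i <- J) P (X i @^-1` A i))%E.

Definition iid_with_distribution (R : realType) (d : measure_display)
    (T : measurableType d) (P : probability T R) (V : finType)
    (X : nat -> T -> V) (nu : V -> R) : Prop :=
  [/\ random_variables X,
      forall i v, P (X i @^-1` [set v]) = (nu v)%:E &
      mutually_independent P X].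

(* The trials are indexed from 0: RZE i is the (i+1)-st trial. *)
Definition iid_scenario (R : realType) (RT CT ZT ET : finType) (C : RT -> CT)
    (Cset : set (CT * ZT -> R)) (nu : RT * ZT * ET -> R)
    (d : measure_display) (T : measurableType d) (P : probability T R)
    (RZE : nat -> T -> RT * ZT * ET) : Prop :=
  [/\ distribution_on nu,
      iid_with_distribution P RZE nu &
      forall e : ET, 0 < dist_of nu snd e ->
        Cset (fun cz => cond_dist nu (CZ_of C) snd cz e)].

(* f i is the value of the PEF used in the (i+1)-st trial. *)
Definition net_log_prob (R : realType) (beta eps : R) (f : nat -> R)
    (n : nat) : \bar R :=
  ((\sum_(i < n) lne (f i)%:E / beta%:E) - (ln (1 / eps) / beta)%:E)%E.

(* Main.v *)
(* Since rho is a mixture of elements of Cset, ln x <= x - 1 bounds the rates of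
   all PEFs uniformly, so g is finite, and some PEF F with power beta has rate
   at rho above g - delta / 2; put G = F `^ beta^-1. The weak law of large
   numbers for ln (F (C_i Z_i)) / beta then leaves a margin of delta / 2 per
   trial, half of which eventually covers the error term kappa n / beta. *)

Require Import Defs.
From HB Require Import structures.
From mathcomp Require Import all_boot all_order all_algebra.
From mathcomp Require Import finmap.
From mathcomp Require Import all_classical all_reals all_analysis.
From mathcomp Require Import ring lra.

Set Implicit Arguments.
Unset Strict Implicit.
Unset Printing Implicit Defensive.

Import Order.TTheory GRing.Theory Num.Theory.
Import numFieldNormedType.Exports.

Local Open Scope classical_set_scope.
Local Open Scope ring_scope.

(** * Second moments and Chebyshev's inequality for a finite product law *)

Section ProductLaw.
Variables (R : realType) (V : finType) (p : V -> R) (n : nat).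
Hypothesis hp : distribution_on p.

Local Notation W x := (\prod_(i < n) p (x i)).

Lemma product_law_ge0 (x : {ffun 'I_n -> V}) : 0 <= W x.
Proof. by apply: prodr_ge0 => i _; exact: hp.1. Qed.

Lemma sum_product_law : \sum_(x : {ffun 'I_n -> V}) W x = 1.
Proof.
rewrite -(bigA_distr_bigA (fun (_ : 'I_n) v => p v)).
by rewrite big1// => i _; exact: hp.2.
Qed.

(** Distinct coordinates are independent, so a cross term factors through the mean of [h], which is
    0. *)
Lemma product_law_cross (h : V -> R) (i j : 'I_n) :
  \sum_v p v * h v = 0 ->
  \sum_(x : {ffun 'I_n -> V}) W x * (h (x i) * h (x j)) =
  (\sum_v p v * h v ^+ 2) *+ (i == j).
Proof.
move=> h0.
(* Inserting [h] as a factor at coordinates [i] and [j] gives a single product over [k], so the sum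
   over [x] becomes a product of sums; if [i = j], both factors meet at one coordinate. *)
pose F (k : 'I_n) v := p v * ((if k == i then h v else 1) *
                              (if k == j then h v else 1)).
transitivity (\sum_(x : {ffun 'I_n -> V}) \prod_k F k (x k)).
  apply: eq_bigr => x _; rewrite !big_split/=; congr (_ * (_ * _)).
    by rewrite -big_mkcond big_pred1_eq.
  by rewrite -big_mkcond big_pred1_eq.
rewrite -bigA_distr_bigA (bigD1 i)//= /F eqxx {F}.
case: (eqVneq i j) => [<-|ij].
  rewrite [X in _ * X]big1 ?mulr1; last first.
    move=> k /negbTE ki; rewrite ki -[RHS]hp.2.
    by apply: eq_bigr => v _; rewrite !mulr1.
  by apply: eq_bigr => v _; rewrite expr2.
by under eq_bigr do rewrite mulr1; rewrite h0 mul0r.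
Qed.

Lemma product_law_second_moment (h : V -> R) :
  \sum_v p v * h v = 0 ->
  \sum_(x : {ffun 'I_n -> V}) W x * (\sum_i h (x i)) ^+ 2 =
  n%:R * \sum_v p v * h v ^+ 2.
Proof.
move=> h0.
transitivity (\sum_(i < n) \sum_(j < n) (\sum_v p v * h v ^+ 2) *+ (i == j)).
  under [RHS]eq_bigr do
    (under eq_bigr do rewrite -(product_law_cross _ _ h0); rewrite exchange_big/=).
  rewrite exchange_big; apply: eq_bigr => x _.
  rewrite expr2 mulr_suml mulr_sumr; apply: eq_bigr => i _.
  by rewrite mulr_sumr mulr_sumr.
rewrite -[in RHS](card_ord n) mulr_natl -sumr_const; apply: eq_bigr => i _.
rewrite (bigD1 i)//= eqxx [X in _ + X]big1 ?addr0// => j ji.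
by rewrite eq_sym (negbTE ji).
Qed.

(** Chebyshev's inequality. The deviation is required only at outcomes of positive weight, since in
    the application logarithms of the PEF are finite only there. *)
Lemma product_law_weak_LLN (h : V -> R) (c : R)
    (B : pred {ffun 'I_n -> V}) :
  (0 < n)%N -> 0 < c -> \sum_v p v * h v = 0 ->
  (forall x, B x -> 0 < W x -> c * n%:R <= `|\sum_i h (x i)|) ->
  \sum_(x | B x) W x <= (\sum_v p v * h v ^+ 2) / c ^+ 2 / n%:R.
Proof.
move=> n0 c0 h0 hB; have nR : 0 < n%:R :> R by rewrite ltr0n.
rewrite ler_pdivlMr// ler_pdivlMr ?exprn_gt0// -(ler_pM2l nR).
rewrite -product_law_second_moment//.
have -> : n%:R * ((\sum_(x | B x) W x) * n%:R * c ^+ 2) =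
          \sum_(x | B x) W x * (c * n%:R) ^+ 2.
  by rewrite -!mulr_suml; ring.
rewrite big_mkcond/=; apply: ler_sum => x _; have W0 := product_law_ge0 x.
case: ifPn => Bx; last by rewrite mulr_ge0// sqr_ge0.
have := W0; rewrite le_eqVlt => /orP[/eqP <-|Wx]; first by rewrite !mul0r.
apply: ler_wpM2l => //.
rewrite -[leRHS]real_normK ?num_real// lerXn2r ?nnegrE ?hB//.
by rewrite mulr_ge0// ltW.
Qed.

End ProductLaw.

(** Reduces probabilities on [T] to finite sums: the event is a finite disjoint union of cylinders,
    and independence gives each its product weight. *)
Lemma iid_event (R : realType) (d : measure_display) (T : measurableType d)
    (P : probability T R) (V : finType) (X : nat -> T -> V) (p : V -> R)
    (n : nat) (Q : pred {ffun 'I_n -> V}) :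
  iid_with_distribution P X p ->
  measurable [set w | Q [ffun i : 'I_n => X i w]] /\
  P [set w | Q [ffun i : 'I_n => X i w]] =
    (\sum_(x | Q x) \prod_(i < n) p (x i))%:E.
Proof.
move=> [mX lawX indX].
pose cyl (x : {ffun 'I_n -> V}) := [set w | [ffun i : 'I_n => X i w] = x].
pose J := [fset i in iota 0 n]%fset.
(* Independence takes a family of sets indexed by all of [nat]; [setT] is the filler at indices
   outside [J]. *)
pose A (x : {ffun 'I_n -> V}) (i : nat) : set V :=
  if insub i is Some j then [set x j] else setT.
have cylE x : cyl x = \bigcap_(i in [set` J]) (X i @^-1` A x i).
  apply/seteqP; split=> w /=.
    move=> <- i; rewrite /J/= inE mem_iota/= add0n => ni.
    by rewrite /A insubT/= ffunE.
  move=> H; apply/ffunP => i; rewrite ffunE.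
  have := H i; rewrite /J/= inE mem_iota/= add0n ltn_ord => /(_ isT).
  by rewrite /A valK.
have Pcyl x : P (cyl x) = (\prod_(i < n) p (x i))%:E.
  rewrite cylE indX -prodEFin.
  rewrite (perm_big (iota 0 n)); last first.
    apply: uniq_perm; rewrite ?fset_uniq ?iota_uniq// => i.
    by rewrite /J inE.
  rewrite -[in LHS](subn0 n) big_mkord; apply: eq_bigr => i _.
  by rewrite /A valK lawX.
have mcyl x : measurable (cyl x).
  by rewrite cylE; apply: fin_bigcap_measurable => // i _; exact: mX.
have -> : [set w | Q [ffun i : 'I_n => X i w]] = \bigcup_(x in [set` Q]) cyl x.
  apply/seteqP; split=> w /=; first by move=> Qw; exists [ffun i : 'I_n => X i w].
  by move=> [x Qx wx]; rewrite wx.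
split; first exact: fin_bigcup_measurable.
rewrite measure_fin_bigcup//; last by move=> x y _ _ [w [<- <-]].
rewrite (fsbigE (enum Q)) ?enum_uniq//=; last 2 first.
- by move=> x /=; rewrite mem_enum.
- by move=> x Qx; rewrite mem_enum => /negP[].
rewrite -sumEFin big_enum_cond/=.
by apply: eq_big => [x|x _]; [rewrite mem_setE andbb|exact: Pcyl].
Qed.

Lemma sum_support (R : realType) (V : finType) (p f : V -> R) :
  (forall v, 0 <= p v) ->
  \sum_(v | 0 < p v) p v * f v = \sum_v p v * f v.
Proof.
move=> p0; rewrite big_mkcond; apply: eq_bigr => v _; case: ltP => // pv0.
by rewrite (le_anti (introT andP (conj pv0 (p0 v)))) mul0r.
Qed.

Lemma ln_le_subr1 (R : realType) (x : R) : 0 < x -> ln x <= x - 1.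
Proof.
by move=> x0; rewrite -{1}(subrKC 1 x) le_ln1Dx// ltrBrDl subrr.
Qed.

(** * Bounds on conditional probabilities and on the mean logarithm of a PEF *)

Section CondDist.
Variables (R : realType) (CT DT ZT : finType) (D : CT -> DT).
Variable sigma : CT * ZT -> R.
Hypothesis hsigma : distribution_on sigma.

(** The numerator is the mass of an event that contains [cz] and lies inside the conditioning event,
    whose own mass is at most 1. *)
Lemma cond_D_given_Z_bounds (cz : CT * ZT) :
  0 < sigma cz -> sigma cz <= cond_D_given_Z D sigma cz <= 1.
Proof.
move=> cz0; have [s0 s1] := hsigma.
rewrite /cond_D_given_Z /cond_dist /dist_of.
set num := (X in X / _); set den := (X in _ / X).
have numE : sigma cz <= num.
  rewrite /num (bigD1 cz) ?eqxx//= lerDl; exact: sumr_ge0.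
have numden : num <= den.
  rewrite /num /den big_mkcond [leRHS]big_mkcond/=; apply: ler_sum => x _.
  by case: (D x.1 == D cz.1); case: (x.2 == cz.2).
have den1 : den <= 1.
  rewrite /den -s1 big_mkcond; apply: ler_sum => x _ /=.
  by case: ifP.
have num0 : 0 < num by exact: lt_le_trans numE.
have den0 : 0 < den by exact: lt_le_trans numden.
rewrite ler_pdivlMr// ler_pdivrMr// mul1r numden andbT.
by apply: (le_trans _ numE); rewrite ler_piMr// ltW.
Qed.

(* By ln x <= x - 1 and sigma(D|Z) >= sigma, the left-hand side is at most beta
   times the entropy of sigma, and - s ln s <= 1 - s. *)
Lemma PEF_mean_ln_le (Cset : set (CT * ZT -> R)) (beta : R)
    (F : CT * ZT -> R) :
  PEF D Cset beta F -> Cset sigma -> (forall cz, 0 < sigma cz -> 0 < F cz) ->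
  \sum_cz sigma cz * ln (F cz) <= beta * #|{: CT * ZT}|%:R.
Proof.
have [s0 s1] := hsigma.
move=> [beta0 F0 hF] /hF; rewrite (sum_support _ s0) => hs Fpos.
(* Summed over [cz], the first term is at most 1 by the PEF inequality, the second cancels it, and
   [beta] is counted once per value. *)
have key cz : sigma cz * ln (F cz) <=
    sigma cz * (F cz * cond_D_given_Z D sigma cz `^ beta) - sigma cz + beta.
  have := s0 cz; rewrite le_eqVlt => /orP[/eqP <-|cz0].
    by rewrite !mul0r subrr add0r ltW.
  have /andP[sc _] := cond_D_given_Z_bounds cz0.
  have c0 : 0 < cond_D_given_Z D sigma cz := lt_le_trans cz0 sc.
  have Fc0 := Fpos _ cz0.
  have : ln (F cz * cond_D_given_Z D sigma cz `^ beta) <=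
         F cz * cond_D_given_Z D sigma cz `^ beta - 1.
    by apply: ln_le_subr1; rewrite mulr_gt0// powR_gt0.
  rewrite lnM ?posrE ?powR_gt0// ln_powR => /(ler_wpM2l (s0 cz)).
  have : ln (sigma cz) <= ln (cond_D_given_Z D sigma cz).
    by rewrite ler_ln.
  move=> /(ler_wpM2l (s0 cz)) /(ler_wpM2l (ltW beta0)).
  have : ln (sigma cz)^-1 <= (sigma cz)^-1 - 1.
    by apply: ln_le_subr1; rewrite invr_gt0.
  rewrite lnV ?posrE// => /(ler_wpM2l (s0 cz)) /(ler_wpM2l (ltW beta0)).
  rewrite [in X in _ <= X -> _]mulrBr mulfV ?gt_eqF//.
  (* The entropy term is bounded by [beta * (1 - sigma cz)]; this drops the negative part. *)
  have : 0 <= beta * sigma cz by rewrite mulr_ge0// ltW.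
  nra.
apply: le_trans (ler_sum _ (fun cz _ => key cz)) _.
rewrite big_split/= sumrB s1 sumr_const mulr_natr.
by rewrite gerDr subr_le0.
Qed.

End CondDist.

(** * Log-prob rates and finiteness of the gain rate *)

Section GainRate.
Variables (R : realType) (CT DT ZT : finType) (D : CT -> DT).
Variable Cset : set (CT * ZT -> R).
Hypothesis hCset : forall sigma, Cset sigma -> distribution_on sigma.

Lemma PEF_cst1 : PEF D Cset 1 (fun=> 1).
Proof.
split => // sigma /[dup] Cs /hCset hs.
rewrite -[leRHS]hs.2 -[leRHS](eq_bigr _ (fun cz _ => mulr1 (sigma cz))).
rewrite -(sum_support _ hs.1).
apply: ler_sum => cz cz0; apply: ler_wpM2l; first exact: ltW.
have /andP[sc c1] := cond_D_given_Z_bounds D hs cz0.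
by rewrite mul1r powRr1// (le_trans _ sc)// ltW.
Qed.

Lemma log_prob_rateE (rho : CT * ZT -> R) (beta : R) (F : CT * ZT -> R) :
  0 < beta -> (forall cz, 0 < rho cz -> 0 < F cz) ->
  log_prob_rate rho beta F =
  ((\sum_(cz | 0 < rho cz) rho cz * ln (F cz)) / beta)%:E.
Proof.
move=> beta0 Fpos; rewrite /log_prob_rate inver gt_eqF// EFinM -sumEFin.
congr (_ * _)%E; apply: eq_bigr => cz cz0.
by rewrite lne_EFin ?Fpos// EFinM.
Qed.

(** One point of positive [rho] with [F] not positive contributes -oo, which makes the whole rate
    -oo. Excluding this allows real logarithms. *)
Lemma log_prob_rate_gtNy (rho : CT * ZT -> R) (beta : R) (F : CT * ZT -> R) :
  0 < beta -> (-oo < log_prob_rate rho beta F)%E ->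
  forall cz, 0 < rho cz -> 0 < F cz.
Proof.
move=> beta0 hlt cz cz0; rewrite ltNge; apply/negP => F0; move: hlt.
suff -> : log_prob_rate rho beta F = -oo%E by rewrite ltxx.
rewrite /log_prob_rate inver gt_eqF//.
suff -> : (\sum_(cz | (0 < rho cz)%R) (rho cz)%:E * lne (F cz)%:E)%E = -oo%E.
  by rewrite gt0_mulNye// lte_fin invr_gt0.
apply/eqP; rewrite esum_eqNy; apply/existsP; exists cz.
by apply/andP; split => //; rewrite le0_lneNy ?lee_fin// gt0_muleNy ?lte_fin.
Qed.

End GainRate.

(* rho is a mixture of elements of Cset, so averaging PEF_mean_ln_le bounds all
   the rates uniformly. *)
Lemma asymptotic_gain_rate_fin_num (R : realType) (RT CT DT ZT ET : finType)
    (C : RT -> CT) (D : CT -> DT) (Cset : set (CT * ZT -> R))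
    (nu : RT * ZT * ET -> R) :
  (forall sigma, Cset sigma -> distribution_on sigma) ->
  distribution_on nu ->
  (forall e : ET, 0 < dist_of nu snd e ->
     Cset (fun cz => cond_dist nu (CZ_of C) snd cz e)) ->
  asymptotic_gain_rate D Cset (dist_of nu (CZ_of C)) \is a fin_num.
Proof.
move=> hCset [nu0 nu1] hcond; set rho := dist_of nu (CZ_of C).
pose lam e := dist_of nu snd e.
pose sig e cz := cond_dist nu (CZ_of C) snd cz e.
have lam0 e : 0 <= lam e by exact: sumr_ge0.
have lam1 : \sum_e lam e = 1.
  by rewrite -nu1 (partition_big snd xpredT).
have rho0 cz : 0 <= rho cz by exact: sumr_ge0.
have mix cz : rho cz = \sum_e lam e * sig e cz.
  rewrite /rho /dist_of (partition_big snd xpredT)//=; apply: eq_bigr => e _.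
  rewrite /sig /cond_dist -/(lam e).
  (* If [lam e = 0], the default value of [cond_dist] is multiplied by 0, and every [nu v] with
     [E = e] vanishes. *)
  have [l0|l0] := eqVneq (lam e) 0; last by rewrite mulrC divfK.
  rewrite l0 mul0r; apply: big1 => v /andP[_ ve].
  exact: (psumr_eq0P (fun v _ => nu0 v) l0).
(* The constant PEF 1 has rate 0, so the supremum is not -oo; the number of values of [CZ] bounds
   all rates from above. *)
apply/fin_numPlt/andP; split.
  apply: (@lt_le_trans _ _ 0%E) => //; apply: ereal_sup_ubound.
  exists 1, (fun=> 1); split; first exact: PEF_cst1.
  by rewrite log_prob_rateE// big1 ?mul0r// => cz _; rewrite ln1 mulr0.
apply: (@le_lt_trans _ _ (#|{: CT * ZT}|%:R)%:E); last exact: ltry.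
apply: ge_ereal_sup => _ [beta [F [hF ->]]]; have [beta0 F0 _] := hF.
have [->|rateNy] := eqVneq (log_prob_rate rho beta F) -oo%E; first exact: leNye.
have Fpos : forall cz, 0 < rho cz -> 0 < F cz.
  by apply: (log_prob_rate_gtNy beta0); rewrite ltNye.
rewrite log_prob_rateE// lee_fin ler_pdivrMr// mulrC.
have -> : \sum_(cz | 0 < rho cz) rho cz * ln (F cz) =
          \sum_e lam e * \sum_cz sig e cz * ln (F cz).
  rewrite sum_support//.
  under [RHS]eq_bigr do rewrite mulr_sumr.
  rewrite exchange_big; apply: eq_bigr => cz _.
  by rewrite mix mulr_suml; apply: eq_bigr => e _; rewrite mulrA.
rewrite -[leRHS]mul1r -[X in X * _]lam1 mulr_suml; apply: ler_sum => e _.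
have := lam0 e; rewrite le_eqVlt => /orP[/eqP <-|le0]; first by rewrite !mul0r.
apply: ler_wpM2l => //; have Ce := hcond e le0; have hs := hCset _ Ce.
apply: (PEF_mean_ln_le hs hF Ce) => cz scz; apply: Fpos.
(* The support of [sig e] lies in that of [rho], because [lam e] is positive. *)
rewrite mix (bigD1 e)//=; apply: ltr_pwDl; first by rewrite mulr_gt0.
by apply: sumr_ge0 => e' _; rewrite mulr_ge0// /sig /cond_dist divr_ge0// sumr_ge0.
Qed.

(** * The weak law applied to a nearly optimal PEF *)

Theorem theorem42 (R : realType) (RT CT DT ZT ET : finType)
    (C : RT -> CT) (D : CT -> DT)
    (Cset : set (CT * ZT -> R))
    (hCset : forall sigma, Cset sigma -> distribution_on sigma)
    (rho : CT * ZT -> R) (g : \bar R)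
    (hg : g = asymptotic_gain_rate D Cset rho)
    (kappa eps : nat -> R)
    (hkappa : kappa =o_\oo (fun _ : nat => 1 : R^o))
    (heps : forall n, eps n = expR (- (kappa n * n%:R)))
    (nu : RT * ZT * ET -> R)
    (hrho : rho = dist_of nu (CZ_of C))
    (d : measure_display) (T : measurableType d) (P : probability T R)
    (RZE : nat -> T -> RT * ZT * ET)
    (hiid : iid_scenario C Cset nu P RZE)
    (delta : R) (hdelta : 0 < delta) :
  exists (beta : R) (G : CT * ZT -> R),
    [/\ 0 < beta,
        forall cz, 0 <= G cz,
        PEF D Cset beta (fun cz => G cz `^ beta) &
        P [set w : T |
            ((g - delta%:E) * n%:R%:E <
             net_log_prob beta (eps n)
               (fun i => G (CZ_of C (RZE i w)) `^ beta)%R n)%E]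
          @[n --> \oo] --> 1%E].
Proof.
have [hnu hX hcond] := hiid; have [nu0 nu1] := hnu.
have gfin : g \is a fin_num.
  by rewrite hg hrho; exact: asymptotic_gain_rate_fin_num hCset hnu hcond.
have rho0 cz : 0 <= rho cz by rewrite hrho; exact: sumr_ge0.
have [beta [F [hF rateE]]] : exists (beta : R) (F : CT * ZT -> R),
    PEF D Cset beta F /\ (g - (delta / 2)%:E < log_prob_rate rho beta F)%E.
  have : (g - (delta / 2)%:E < ereal_sup [set x | exists (beta : R) F,
      PEF D Cset beta F /\ x = log_prob_rate rho beta F])%E.
    by rewrite -/(asymptotic_gain_rate D Cset rho) -hg lteBlDr// lteDl// lte_fin divr_gt0.
  by move=> /ereal_sup_gt[_ [beta [F [hF ->]]] hlt]; exists beta, F.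
have [beta0 F0 _] := hF.
have Fpos : forall cz, 0 < rho cz -> 0 < F cz.
  apply: (log_prob_rate_gtNy beta0); apply: lt_trans rateE.
  by rewrite -(fineK gfin) -EFinB ltNyr.
rewrite (log_prob_rateE beta0 Fpos) (sum_support _ rho0) in rateE.
set mu := (_ / beta)%R in rateE.
rewrite -(fineK gfin) -EFinB lte_fin in rateE.
exists beta, (fun cz => F cz `^ beta^-1).
have GE cz : (F cz `^ beta^-1) `^ beta = F cz.
  by rewrite -powRrM mulVf ?gt_eqF// powRr1.
have GEf : (fun cz => (F cz `^ beta^-1) `^ beta) = F by apply/funext => cz; exact: GE.
split => //; [by move=> cz; exact: powR_ge0|by rewrite GEf|].
(* The log-prob of one trial, centred at its mean [mu], the rate of [F]. *)
pose h (v : RT * ZT * ET) := ln (F (CZ_of C v)) / beta - mu.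
have h0 : \sum_v nu v * h v = 0.
  under eq_bigr do rewrite mulrBr mulrA.
  rewrite sumrB -!mulr_suml nu1 mul1r; apply/eqP; rewrite subr_eq0; apply/eqP.
  rewrite /mu; congr (_ / _).
  rewrite (partition_big (CZ_of C) xpredT)//=; apply: eq_bigr => cz _.
  rewrite hrho /dist_of mulr_suml; apply: eq_bigr => v /eqP <-.
  by [].
(* The gain event as a condition on the vector of the first [n] outcomes, so that [iid_event]
   applies. *)
pose Q n (x : {ffun 'I_n -> RT * ZT * ET}) :=
  ((g - delta%:E) * n%:R%:E <
    (\sum_(i < n) lne (F (CZ_of C (x i)))%:E / beta%:E)
      - (ln (1 / eps n) / beta)%:E)%E.
pose W n (x : {ffun 'I_n -> RT * ZT * ET}) := \prod_(i < n) nu (x i).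
have evE n : P [set w : T | ((g - delta%:E) * n%:R%:E <
             net_log_prob beta (eps n)
               (fun i => (F (CZ_of C (RZE i w)) `^ beta^-1) `^ beta)%R n)%E] =
    (1 - \sum_(x | ~~ Q n x) W n x)%:E.
  have [_ PQ] := iid_event (Q n) hX.
  rewrite -[X in (X - _)%:E](sum_product_law n hnu) (bigID (Q n))/= addrK -PQ.
  congr (P _); apply/funext => w /=; rewrite /net_log_prob /Q.
  congr (is_true (_ < _ - _))%E.
  by apply: eq_bigr => i _; rewrite GE ffunE.
rewrite (funext evE); apply: cvg_EFin; first by near=> n.
rewrite /=.
(* Of the margin [delta / 2], the error term takes at most [delta / 4]; a failure is thus a
   deviation of at least [delta / 4] per trial, with Chebyshev bound [K / n]. *)
pose K := (\sum_v nu v * h v ^+ 2) / (delta / 4) ^+ 2.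
apply: (@squeeze_cvgr _ _ _ _ (fun n => 1 - K / n%:R) (fun=> 1)).
- have c0 : 0 < beta * (delta / 4) by rewrite mulr_gt0// divr_gt0.
  move/eqoP : hkappa => /(_ _ c0) hk; near=> n.
  have n0 : (0 < n)%N by near: n; exact: nbhs_infty_gt.
  have nR : 0 < n%:R :> R by rewrite ltr0n.
  have kn : kappa n <= beta * (delta / 4).
    apply: le_trans (ler_norm _) _.
    by have : `|kappa n| <= beta * (delta / 4) * `|(1 : R^o)|; [near: n|rewrite normr1 mulr1].
  rewrite lerD2l lerN2 gerDl oppr_le0 sumr_ge0 ?andbT; last first.
    by move=> x _; exact: product_law_ge0.
  apply: product_law_weak_LLN => //; first by rewrite divr_gt0.
  move=> x nQ W0.
  (* Positive weight puts every outcome in the support of [nu], where [F] is positive and [lne] is a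
     real logarithm. *)
  have nupos i : 0 < nu (x i).
    by rewrite lt0r nu0 andbT; move: W0; rewrite lt0r => /andP[/prodf_neq0 ->].
  have Fx i : 0 < F (CZ_of C (x i)).
    apply: Fpos; rewrite hrho /dist_of (bigD1 (x i))//=.
    by rewrite ltr_pwDl// sumr_ge0.
  move: nQ; rewrite /Q -leNgt.
  under eq_bigr => i _ do rewrite lne_EFin// inver gt_eqF// -EFinM.
  rewrite sumEFin -(fineK gfin) -!EFinB -EFinM lee_fin heps.
  rewrite div1r expRN invrK expRK => hle.
  rewrite /h sumrB sumr_const card_ord -mulr_natr.
  have kbeta : kappa n * n%:R / beta <= delta / 4 * n%:R.
    by rewrite ler_pdivrMr// mulrAC ler_pM2r// mulrC.
  rewrite -(ltr_pM2r nR) in rateE.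
  (* Failure is a deviation below the mean, hence the change of sign. *)
  rewrite -normrN; apply: le_trans (ler_norm _).
  lra.
- rewrite -[X in _ --> X]subr0; apply: cvgB; first exact: cvg_cst.
  rewrite -[X in _ --> X](mulr0 K); apply: cvgM; first exact: cvg_cst.
  (* The harmonic sequence is [1 / (n + 1)], hence the shift. *)
  by rewrite -cvg_shiftS; exact: cvg_harmonic.
- exact: cvg_cst.
Unshelve. all: by end_near.
Qed.
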